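(* Let $m$ be an even positive integer, $n$ a positive integer, and let $\mathcal{C}$ be an order $m$ dimension $n$ symmetric Cauchy tensor with generating vector $c\in\mathbb{R}^n$. Let $f(x)=\mathcal{C}x^m$. Then $\mathcal{C}$ is positive semi-definite if and only if $f$ is monotone increasing in $\mathbb{R}^n_+$.
   Context: $[n]=\{1,\ldots,n\}$, and $\mathbb{R}^n_+$ is the nonnegative orthant of $\mathbb{R}^n$. An order $m$ dimension $n$ symmetric Cauchy tensor with generating vector $c=(c_1,\ldots,c_n)\in\mathbb{R}^n$ is the real tensor $\mathcal{C}=(c_{i_1\cdots i_m})$ with entries $c_{i_1i_2\cdots i_m}=\frac{1}{c_{i_1}+c_{i_2}+\cdots+c_{i_m}}$, $i_1,\ldots,i_m\in[n]$, where it is assumed that $c_{i_1}+\cdots+c_{i_m}\neq 0$ for all $i_1,\ldots,i_m\in[n]$. For an order $m$ dimension $n$ tensor $\mathcal{A}=(a_{i_1\cdots i_m})$ put $\mathcal{A}x^m:=\sum_{i_1,\ldots,i_m\in[n]}a_{i_1\cdots i_m}x_{i_1}\cdots x_{i_m}$; $\mathcal{A}$ is positive semi-definite if $\mathcal{A}x^m\ge 0$ for all $x\in\mathbb{R}^n$. For $x,y\in\mathbb{R}^n$, $x\ge y$ means $x_i\ge y_i$ for all $i\in[n]$. A function $f$ is monotone increasing in $X\subseteq\mathbb{R}^n$ if $f(x)\ge f(y)$ for all $x,y\in X$ with $x\ge y$. *)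

(* Defs.v *)
From mathcomp Require Import all_boot all_order all_algebra.
From mathcomp Require Import classical_sets reals.

Set Implicit Arguments.
Unset Strict Implicit.
Unset Printing Implicit Defensive.

Import Order.TTheory GRing.Theory Num.Theory.
Local Open Scope ring_scope.
Local Open Scope classical_set_scope.

(* A multi-index (i_1, ..., i_m) is a function 'I_m -> 'I_n; the index set
   {1, ..., n} is represented by 'I_n = {0, ..., n - 1}. *)
Definition tensor (R : realType) (m n : nat) : Type :=
  {ffun {ffun 'I_m -> 'I_n} -> R}.

Definition tensor_form (R : realType) (m n : nat) (A : tensor R m n)
    (x : 'rV[R]_n) : R :=
  \sum_(i : {ffun 'I_m -> 'I_n}) A i * \prod_(k < m) x 0 (i k).

Definition psd_tensor (R : realType) (m n : nat) (A : tensor R m n) : Prop :=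
  forall x : 'rV[R]_n, 0 <= tensor_form A x.

(* The nonvanishing of the denominators is part of the definition: inversion is
   total in MathComp, with 0^-1 = 0. *)
Definition is_cauchy_tensor (R : realType) (m n : nat) (c : 'rV[R]_n)
    (C : tensor R m n) : Prop :=
  (forall i : {ffun 'I_m -> 'I_n}, \sum_(k < m) c 0 (i k) != 0) /\
  (forall i : {ffun 'I_m -> 'I_n}, C i = (\sum_(k < m) c 0 (i k))^-1).

Definition vec_le (R : realType) (n : nat) (x y : 'rV[R]_n) : Prop :=
  forall i : 'I_n, x 0 i <= y 0 i.

Definition nonneg_orthant (R : realType) (n : nat) : set 'rV[R]_n :=
  [set x | vec_le 0 x].

Definition monotone_increasing_in (R : realType) (n : nat) (X : set 'rV[R]_n)
    (f : 'rV[R]_n -> R) : Prop :=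
  forall x y : 'rV[R]_n, X x -> X y -> vec_le y x -> f y <= f x.

(* Main.v *)
(** A Cauchy tensor takes the value 1 / (m c_j) at the j-th basis vector, so
    each of the two properties forces c > 0. Conversely, if c > 0 then all the
    entries are positive, whence monotonicity on the orthant; and
    positive semi-definiteness follows from
      C x^m = int_0^oo (sum_j x_j exp (- s c_j))^m ds >= 0   (m even).
    The integral is avoided: the integrand is minus the derivative of
    G s = C y(s)^m with y_j(s) = x_j exp (- s c_j), so G is nonincreasing; as
    G tends to 0 at infinity, G 0 = C x^m is nonnegative. *)
Require Import Defs.
From mathcomp Require Import all_boot all_order all_algebra.
From mathcomp Require Import classical_sets reals.
From mathcomp Require Import all_classical all_reals all_analysis.

Set Implicit Arguments.
Unset Strict Implicit.
Unset Printing Implicit Defensive.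

Import Order.TTheory GRing.Theory Num.Theory.
Import numFieldNormedType.Exports.

Section CauchyTensor.
Local Open Scope ring_scope.
Local Open Scope classical_set_scope.

Lemma is_derive_big_sum (R : realType) (I : Type) (r : seq I)
    (F : I -> R -> R) (dF : I -> R) (s : R) :
  (forall i, is_derive s 1 (F i) (dF i)) ->
  is_derive s 1 (fun t => \sum_(i <- r) F i t) (\sum_(i <- r) dF i).
Proof.
move=> FdF; elim: r => [|i r IHr].
  rewrite big_nil; under eq_fun do rewrite big_nil.
  exact: is_derive_cst.
rewrite big_cons; under eq_fun do rewrite big_cons.
exact: is_deriveD.
Qed.

Lemma is_derive_expR_scale (R : realType) (a s : R) :
  is_derive s 1 (fun t => expR (- (t * a))) (- a * expR (- (s * a))).
Proof.
have dlin : is_derive s 1 (fun t : R => - (t * a)) (- a).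
  have -> : (fun t : R => - (t * a)) = (- a) \*: (@id R).
    by apply/funext => t /=; rewrite -mulrN mulrC.
  have := is_deriveZ (- a) (is_derive_id s 1).
  by rewrite [_ *: 1]mulr1.
by rewrite mulrC; apply: (@is_derive1_comp R expR).
Qed.

Lemma cvg_expR_scale (R : realType) (a : R) :
  0 < a -> expR (- (s * a)) @[s --> +oo] --> (0 : R).
Proof.
move=> a_gt0.
apply: (@cvg_comp _ _ _ (fun s : R => s * a) (fun t => expR (- t))).
  exact: (gt0_cvgMly a_gt0 cvg_id).
exact: cvgr_expR.
Qed.

Variables (R : realType) (m n : nat) (c : 'rV[R]_n) (C : tensor R m n).

Lemma tensor_form_delta (j : 'I_n) :
  tensor_form C (delta_mx 0 j) = C [ffun=> j].
Proof.
rewrite /tensor_form (bigD1 [ffun=> j])//= [X in _ * X]big1; last first.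
  by move=> k _; rewrite ffunE mxE !eqxx.
rewrite mulr1 big1 ?addr0// => i /eqP ij.
have [k /eqP ikj|all_j] := pickP (fun k => i k != j).
  by rewrite (bigD1 k)//= mxE eqxx/= (introF eqP ikj) mul0r mulr0.
by case: ij; apply/ffunP => k; rewrite ffunE; apply/eqP/negbFE/all_j.
Qed.

Lemma tensor_form0 : (0 < m)%N -> tensor_form C 0 = 0.
Proof.
move=> m_gt0; apply: big1 => i _.
by rewrite (bigD1 (Ordinal m_gt0))//= mxE mul0r mulr0.
Qed.

(** Distributivity expands the power into one term per multi-index, and the exponentials of a term
    merge into one whose exponent carries the Cauchy denominator. This makes the derivative of [G]
    below an exact [m]-th power up to sign. *)
Lemma sum_prod_expR (x : 'rV[R]_n) (s : R) :
  \sum_(i : {ffun 'I_m -> 'I_n})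
    (\prod_(k < m) x 0 (i k)) * expR (- (s * \sum_(k < m) c 0 (i k))) =
  (\sum_(j < n) x 0 j * expR (- (s * c 0 j))) ^+ m.
Proof.
rewrite -[in RHS](card_ord m) -prodr_const bigA_distr_bigA.
apply: eq_bigr => i _.
by rewrite mulr_sumr -sumrN expR_sum big_split.
Qed.

Hypothesis C_cauchy : is_cauchy_tensor c C.

(** The denominator of this entry is [c 0 j *+ m], and its nonvanishing upgrades the weak inequality
    to a strict one. *)
Lemma cauchy_diag_ge0 (j : 'I_n) :
  (0 < m)%N -> 0 <= C [ffun=> j] -> 0 < c 0 j.
Proof.
move=> m_gt0; rewrite C_cauchy.2 invr_ge0 => sum_ge0.
have := C_cauchy.1 [ffun=> j]; move: sum_ge0.
under eq_bigr do rewrite ffunE.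
rewrite sumr_const card_ord => cm_ge0 cm_neq0.
by rewrite -(pmulrn_lgt0 _ m_gt0) lt_def cm_neq0.
Qed.

Hypothesis c_gt0 : forall j, 0 < c 0 j.

Lemma cauchy_denominator_gt0 (i : {ffun 'I_m -> 'I_n}) :
  0 < \sum_(k < m) c 0 (i k).
Proof.
by rewrite lt_def C_cauchy.1 sumr_ge0// => k _; rewrite ltW.
Qed.

Lemma cauchy_monotone :
  monotone_increasing_in (@nonneg_orthant R n) (fun x => tensor_form C x).
Proof.
move=> x y x_ge0 y_ge0 le_yx; apply: ler_sum => i _.
apply: ler_wpM2l.
  by rewrite C_cauchy.2 invr_ge0 ltW// cauchy_denominator_gt0.
apply: ler_prod => k _; rewrite le_yx andbT.
by have := y_ge0 (i k); rewrite mxE.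
Qed.

Lemma cauchy_psd : ~~ odd m -> psd_tensor C.
Proof.
move=> m_even x.
pose sigma (i : {ffun 'I_m -> 'I_n}) := \sum_(k < m) c 0 (i k).
pose p (i : {ffun 'I_m -> 'I_n}) := \prod_(k < m) x 0 (i k).
pose G (s : R) := \sum_i C i * p i * expR (- (s * sigma i)).
have dG (s : R) : is_derive s 1 G
    (- (\sum_(j < n) x 0 j * expR (- (s * c 0 j))) ^+ m).
  rewrite -sum_prod_expR -sumrN; apply: is_derive_big_sum => i.
  (* Differentiation brings down the factor [- sigma i], which cancels against [C i], the inverse of
     [sigma i]. *)
  have -> : - (p i * expR (- (s * sigma i))) =
      (C i * p i) *: (- sigma i * expR (- (s * sigma i))).
    rewrite /GRing.scale/= C_cauchy.2 -/(sigma i) mulNr mulrN; congr (- _).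
    by rewrite [_^-1 * _]mulrC -mulrA mulKf ?C_cauchy.1.
  have dexp := is_derive_expR_scale (sigma i) s.
  exact: (is_deriveZ (C i * p i) dexp).
have G_cvg : G s @[s --> +oo] --> (0 : R).
  have -> : 0 = \sum_i C i * p i * 0 :> R by rewrite big1// => i _; rewrite mulr0.
  apply: (@cvg_big R _ +%R 0 xpredT (@add_continuous R) _ _ _
    (fun i (s : R) => C i * p i * expR (- (s * sigma i)))) => i _.
  apply: cvgM; first exact: cvg_cst.
  exact/cvg_expR_scale/cauchy_denominator_gt0.
have -> : tensor_form C x = G 0.
  by apply: eq_bigr => i _; rewrite mul0r oppr0 expR0 mulr1.
(* The limit 0 is at most [G 0] once [G s <= G 0] for all large [s]; nonnegative [s] suffice. *)
apply: (cvgr_to_le G_cvg); near=> s.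
apply: (@ler0_derive1_nincry R G 0) => //.
(* Evenness of [m] fixes the sign of the derivative. *)
- by move=> t _; rewrite derive1E derive_val oppr_le0 exprn_even_ge0.
- apply: continuous_subspaceT => t.
  exact/differentiable_continuous/derivable1_diffP.
Unshelve. all: by end_near. Qed.

End CauchyTensor.

Theorem theorem2p4 (R : realType) (m n : nat) (m_gt0 : (0 < m)%N)
    (m_even : ~~ odd m) (n_gt0 : (0 < n)%N) (c : 'rV[R]_n) (C : tensor R m n)
    (C_cauchy : is_cauchy_tensor c C) :
  psd_tensor C <->
  monotone_increasing_in (@nonneg_orthant R n) (fun x => tensor_form C x).
Proof.
split=> [C_psd|C_mono].
  apply: (cauchy_monotone C_cauchy) => j.
  apply: (cauchy_diag_ge0 C_cauchy m_gt0).
  by rewrite -tensor_form_delta.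
apply: (cauchy_psd C_cauchy _ m_even) => j.
apply: (cauchy_diag_ge0 C_cauchy m_gt0).
(* The form vanishes at the origin, so monotonicity between 0 and the [j]-th basis vector bounds the
   diagonal entry below. *)
rewrite -tensor_form_delta -(tensor_form0 C m_gt0).
have delta_ge0 : vec_le 0%R (delta_mx 0%R j : 'rV[R]_n).
  by move=> i; rewrite !mxE ler0n.
by apply: C_mono => // i.
Qed.
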